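(* The complex tame Butcher group $\mathcal B^{\mathbb C}_{TM}$, endowed with the subspace topology induced by $M_{\mathbb C}$ and the global chart $\Psi\colon\mathcal B^{\mathbb C}_{TM}\to M^*_{\mathbb C}$, $a\mapsto a-e$, is a complex analytic Lie group modelled on the Silva space $M^*_{\mathbb C}$ (i.e. the group multiplication and inversion are complex analytic).
   Context: $\mathcal T_0$ is the set of rooted trees (finite, up to root-preserving isomorphism) together with the empty tree $\emptyset$; $|\tau|$ is the number of vertices. The complex Butcher group $G^{\mathbb C}_{TM}=\{a\colon\mathcal T_0\to\mathbb C\mid a(\emptyset)=1\}$ has product $(a\cdot b)(\tau)=\sum_{s\in\mathrm{OST}(\tau)}b(s_\tau)\prod_{\theta\in\tau\setminus s}a(\theta)$ and inverse $a^{-1}(\tau)=\sum_{p\in\mathcal P(\tau)}(-1)^{\#(\tau\setminus p)}\prod_{\theta\in\tau\setminus p}a(\theta)$, where $\mathrm{OST}(\tau)$ is the set of ordered subtrees (vertex subsets connected in $\tau$ containing the root if nonempty), $s_\tau$ the induced rooted tree, $\tau\setminus s$ the forest remaining after deleting $s$ and adjacent edges, $\mathcal P(\tau)$ the set of subsets $p$ of edges, $\tau\setminus p$ the forest remaining after deleting the edges of $p$, $\#$ the number of trees; the unit is $e$ with $e(\emptyset)=1$ and $e(\tau)=0$ otherwise. $\mathcal B^{\mathbb C}_{TM}=\{a\in G^{\mathbb C}_{TM}\mid\exists C,K>0\ \forall\tau\ne\emptyset:\ |a(\tau)|\le CK^{|\tau|}\}$. With $\omega_k(\tau)=2^{-k|\tau|}$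 and Banach spaces $\mathbb C^{\mathcal T_0}(\omega_k)=\{a\mid\sup_\tau|a(\tau)|\omega_k(\tau)<\infty\}$, $M_{\mathbb C}=\bigcup_k\mathbb C^{\mathcal T_0}(\omega_k)$ carries the locally convex inductive limit topology (a Silva space) and $M^*_{\mathbb C}=\{a\in M_{\mathbb C}\mid a(\emptyset)=0\}$; $\mathcal B^{\mathbb C}_{TM}=e+M^*_{\mathbb C}$ as sets. Differentiability is in the sense of Bastiani/Keller ($C^r$ maps between locally convex spaces via continuous iterated directional derivatives); complex analytic means $C^\infty_{\mathbb C}$. *)

(* Defs.v *)
From HB Require Import structures.
From mathcomp Require Import all_boot all_order all_algebra.
From mathcomp Require Import reals complex.
From Stdlib Require List Permutation.
Import (notations) Permutation.
Set Implicit Arguments. Unset Strict Implicit. Unset Printing Implicit Defensive.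
Import Order.TTheory GRing.Theory Num.Theory.
Local Open Scope ring_scope.

(* Rooted trees.  Planar (ordered) rooted trees; rooted trees up to    *)
(* root-preserving isomorphism are their classes modulo [tiso].        *)
Inductive ptree := PNode of seq ptree.

Inductive tiso : ptree -> ptree -> Prop :=
  | TIso (ts us vs : seq ptree) :
      List.Forall2 tiso ts us -> Permutation.Permutation us vs -> tiso (PNode ts) (PNode vs).

Fixpoint tsize (t : ptree) : nat :=
  let: PNode ts := t in (sumn (map tsize ts)).+1.

(* |tau| for tau in T_0 = trees + empty tree (None) *)
Definition osize (t : option ptree) : nat :=
  if t is Some u then tsize u else 0%N.

Fixpoint choices {X : Type} (ls : seq (seq X)) : seq (seq X) :=
  match ls with
  | [::] => [:: [::]]
  | l :: ls' => [seq x :: c | x <- l, c <- choices ls']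
  end.

(* Ordered subtrees: the list of all pairs (s_tau, tau \ s), s ranging
   over OST(tau) (each once); None encodes the empty subtree. *)
Fixpoint ost (t : ptree) : seq (option ptree * seq ptree) :=
  let: PNode ts := t in
  (None, [:: t]) ::
  [seq (Some (PNode (pmap (fun q => q.1) c)), flatten (map (fun q => q.2) c))
  | c <- choices (map ost ts)].

(* Edge subsets p of tau: list of pairs (component containing the root,
   the other components) of the forest tau \ p, each p once. For each
   child, Some r = edge kept (r attached), None = edge cut (r becomes a
   separate component). *)
Fixpoint cuts (t : ptree) : seq (ptree * seq ptree) :=
  let: PNode ts := t in
  [seq (PNode (pmap (fun q => q.1) c), flatten (map (fun q => q.2) c))
  | c <- choices (map (fun u =>
        flatten [seq [:: (Some rf.1, rf.2); (None, rf.1 :: rf.2)] | rf <- cuts u])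
        ts)].

Section Butcher.
Variable R : realType.
Local Notation C := (R[i]).

(* functions T_0 -> C; None is the empty tree *)
Definition tfun := option ptree -> C.

Definition iso_inv (a : tfun) : Prop :=
  forall t u, tiso t u -> a (Some t) = a (Some u).

Definition bprod (a b : tfun) : tfun := fun t =>
  match t with
  | None => b None
  | Some u => \sum_(p <- ost u) b p.1 * \prod_(th <- p.2) a (Some th)
  end.

(* Butcher inverse a^{-1}(tau); #(tau \ p) = 1 + size p.2 *)
Definition binv (a : tfun) : tfun := fun t =>
  match t with
  | None => 1
  | Some u => \sum_(p <- cuts u)
       (-1) ^+ (size p.2).+1 * (a (Some p.1) * \prod_(th <- p.2) a (Some th))
  end.

Definition bunit : tfun := fun t => if t is None then 1 else 0.

Definition tadd (a b : tfun) : tfun := fun t => a t + b t.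
Definition tscale (l : C) (a : tfun) : tfun := fun t => l * a t.

Definition GTM (a : tfun) : Prop := iso_inv a /\ a None = 1.

Definition BTM (a : tfun) : Prop :=
  GTM a /\ exists c K : C, 0 < c /\ 0 < K /\
    forall u : ptree, `|a (Some u)| <= c * K ^+ tsize u.

Definition inEk (k : nat) (a : tfun) : Prop :=
  exists c : C, forall t, `|a t| / 2%:R ^+ (k * osize t) <= c.

Definition Mset (a : tfun) : Prop := iso_inv a /\ exists k, inEk k a.
Definition Mstar (a : tfun) : Prop := Mset a /\ a None = 0.

(* 0-neighbourhoods of the locally convex inductive limit topology:
   absolutely convex sets V whose trace on every step C^{T_0}(omega_k)
   is a 0-neighbourhood of that Banach space. *)
Definition nbhd0 (V : tfun -> Prop) : Prop :=
  (forall a b (l m : C), Mset a -> Mset b -> V a -> V b ->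
     `|l| + `|m| <= 1 -> V (tadd (tscale l a) (tscale m b))) /\
  (forall k, exists eps : C, 0 < eps /\
     forall a, Mset a -> (forall t, `|a t| / 2%:R ^+ (k * osize t) <= eps) -> V a).

(* Topological vector spaces given concretely: a carrier type, a domain *)
(* (the actual space), vector operations and the open sets (relative   *)
(* to the domain).                                                      *)
Record space := Space {
  pt : Type;
  pdom : pt -> Prop;
  padd : pt -> pt -> pt;
  pscale : C -> pt -> pt;
  popen : (pt -> Prop) -> Prop }.

Definition pspace (E F : space) : space := {|
  pt := (pt E * pt F)%type;
  pdom := fun p => @pdom E p.1 /\ @pdom F p.2;
  padd := fun p q => (padd p.1 q.1, padd p.2 q.2);
  pscale := fun l p => (pscale l p.1, pscale l p.2);
  popen := fun O => forall x y, @pdom E x -> @pdom F y -> O (x, y) ->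
     exists (A : pt E -> Prop) (B : pt F -> Prop), popen A /\ popen B /\ A x /\ B y /\
       forall u v, @pdom E u -> @pdom F v -> A u -> B v -> O (u, v) |}.

Definition MstarSpace : space := {|
  pt := tfun; pdom := Mstar; padd := tadd; pscale := tscale;
  popen := fun O => forall x, Mstar x -> O x ->
     exists V, nbhd0 V /\ forall v, Mstar v -> V v -> O (tadd x v) |}.

Section Calculus.
Definition pcont (E F : space) (f : pt E -> pt F) : Prop :=
  forall x, @pdom E x -> forall B, popen B -> B (f x) ->
    exists A, popen A /\ A x /\ forall y, @pdom E y -> A y -> B (f y).

Definition dirderiv (E F : space) (f : pt E -> pt F) (x h : pt E) (L : pt F) : Prop :=
  @pdom F L /\
  forall B, popen B -> B L ->
    exists d : C, 0 < d /\ forall t : C, t != 0 -> `|t| < d ->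
      B (pscale t^-1 (padd (f (padd x (pscale t h))) (pscale (-1) (f x)))).

(* Bastiani/Keller C^k over C (recursive form: f is C^{k+1} iff it is C^1
   and df : E x E -> F is C^k) *)
Fixpoint Ck (k : nat) (E F : space) (f : pt E -> pt F) : Prop :=
  pcont f /\
  match k with
  | 0%N => True
  | k'.+1 => exists g : pt (pspace E E) -> pt F,
      (forall x h, @pdom E x -> @pdom E h -> dirderiv f x h (g (x, h))) /\
      Ck k' g
  end.

(* complex analytic = C^infty_C, for maps defined on the whole space *)
Definition Canalytic (E F : space) (f : pt E -> pt F) : Prop :=
  (forall x, @pdom E x -> @pdom F (f x)) /\ forall k, Ck k f.
End Calculus.

Definition Psi (a : tfun) : tfun := tadd a (tscale (-1) bunit).
Definition Psiinv (x : tfun) : tfun := tadd x bunit.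

Definition mul_chart (p : tfun * tfun) : tfun := Psi (bprod (Psiinv p.1) (Psiinv p.2)).
Definition inv_chart (x : tfun) : tfun := Psi (binv (Psiinv x)).

End Butcher.

(* Main.v *)
(* In the chart both group operations send a point to a function whose value at a
   tree t is a polynomial in finitely many coordinates, with coefficients of total
   size at most 2^(K|t|) and monomials whose trees have at most |t| vertices in
   total. Such a family maps M* to M*, and its formal derivative is a family of the
   same kind, so C^k for all k follows once these families are continuous and once
   differentiable. Differentiability holds because the second order remainder is
   O(|l|^2) inside a single Banach step. For continuity, 0 has a base of
   neighbourhoods {|a t| <= 2^(kap|t| * |t| - D)} with kap nondecreasing and
   unbounded; monotonicity makes the product of such bounds over trees of total
   size n at most 2^(kap n * n), while exponential factors 2^(m n) are absorbed by
   shifting kap. *)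
From Pilot Require Import Defs.
From mathcomp Require Import all_boot all_order all_algebra.
From mathcomp Require Import boolp reals complex.
From mathcomp Require Import ring zify.
From Stdlib Require List Permutation.
(* Again, since mathcomp's [tuple.tsize] would otherwise hide the size of trees. *)
Import Pilot.Defs.
Import Order.TTheory GRing.Theory Num.Theory.
Local Open Scope ring_scope.
Set Implicit Arguments. Unset Strict Implicit. Unset Printing Implicit Defensive.

(** * Rooted trees, ordered subtrees and edge cuts *)

(** The children of a node sit inside a list, so the generated induction principle gives no
    hypothesis on them; this one does. *)
Lemma ptree_nested_ind (P : ptree -> Prop) :
  (forall ts, List.Forall P ts -> P (PNode ts)) -> forall t, P t.
Proof.
move=> H; fix IH 1; case=> ts; apply: H.
by elim: ts => [|t ts IHts]; constructor.
Qed.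

Lemma tsize_gt0 t : (0 < tsize t)%N. Proof. by case: t. Qed.

Definition pair_weight (q : option ptree * seq ptree) : nat :=
  (osize q.1 + sumn (map tsize q.2))%N.

Lemma choices_weight (X Y : Type) (f : Y -> seq X) (w : X -> nat) (n : Y -> nat) ts :
  List.Forall (fun t => all (fun x => w x == n t) (f t)) ts ->
  all (fun c => sumn (map w c) == sumn (map n ts)) (choices (map f ts)).
Proof.
elim=> [|t us ft _ IH] //=.
elim: (f t) ft => [|x l IHl] //= /andP[/eqP wx /IHl wl].
rewrite all_cat wl andbT all_map; apply: sub_all IH => c /= /eqP ->.
by rewrite wx.
Qed.

Lemma choices_size (X Y : Type) (f : Y -> seq X) (n : Y -> nat) ts :
  List.Forall (fun t => size (f t) <= 2 ^ n t)%N ts ->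
  (size (choices (map f ts)) <= 2 ^ sumn (map n ts))%N.
Proof.
elim=> [|t us ft _ IH] //=.
by rewrite size_allpairs expnD leq_mul.
Qed.

Lemma node_weight c :
  pair_weight (Some (PNode (pmap (fun q => q.1) c)), flatten (map (fun q => q.2) c))
  = (sumn (map pair_weight c)).+1.
Proof.
rewrite /pair_weight /= addSn; congr _.+1.
elim: c => [|[[r|] l] c IH] //=; rewrite map_cat sumn_cat -?IH ?add0n.
  by rewrite -!addnA; congr addn; rewrite addnCA.
by rewrite addnCA.
Qed.

Lemma ost_weight t : all (fun p => pair_weight p == tsize t) (ost t).
Proof.
elim/ptree_nested_ind: t => ts IH /=.
apply/andP; split; first by rewrite /pair_weight /= addn0.
rewrite all_map; apply: sub_all (choices_weight IH) => c /= /eqP <-.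
by rewrite node_weight.
Qed.

Lemma ost_size t : (size (ost t) <= 2 ^ tsize t)%N.
Proof.
elim/ptree_nested_ind: t => ts IH /=.
(* The extra [1] is the empty subtree; it is absorbed by 1 + 2^n <= 2^(n+1), with n the total size
   of the children. *)
rewrite size_map expnS mul2n -addnn -add1n.
by apply: leq_add (choices_size IH); rewrite expn_gt0.
Qed.

(** The anonymous function in the body of [cuts], named so that [cuts] has the same shape as the
    main branch of [ost] and the lemmas on [choices] serve both. *)
Definition cut_choices u : seq (option ptree * seq ptree) :=
  flatten [seq [:: (Some rf.1, rf.2); (None, rf.1 :: rf.2)] | rf <- cuts u].

Lemma cuts_node ts : cuts (PNode ts) =
  [seq (PNode (pmap (fun q => q.1) c), flatten (map (fun q => q.2) c))
  | c <- choices (map cut_choices ts)].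
Proof. by []. Qed.

Lemma cuts_weight t :
  all (fun p => tsize p.1 + sumn (map tsize p.2) == tsize t)%N (cuts t).
Proof.
elim/ptree_nested_ind: t => ts IH; rewrite cuts_node.
have H : List.Forall
    (fun t => all (fun x => pair_weight x == tsize t) (cut_choices t)) ts.
  apply: List.Forall_impl IH => t; rewrite /cut_choices.
  by elim: (cuts t) => [|[r l] cs IHc] //= /andP[wr /IHc ->]; rewrite /pair_weight /= !wr.
rewrite all_map; apply: sub_all (choices_weight H) => c /= /eqP <-.
by move/eqP: (node_weight c).
Qed.

(** The factor 2 is what the induction needs: every cut of a child is used twice, with the edge to
    the parent kept or removed. *)
Lemma cuts_size t : (2 * size (cuts t) <= 2 ^ tsize t)%N.
Proof.
elim/ptree_nested_ind: t => ts IH; rewrite cuts_node size_map expnS leq_mul2l /=.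
apply: choices_size; apply: List.Forall_impl IH => t; apply: leq_trans.
rewrite /cut_choices.
by elim: (cuts t) => [|rf cs IHc] //=; rewrite mulnS !addSn add0n !ltnS.
Qed.

(** * Invariance under tree isomorphism *)

Lemma tiso_node ts u : tiso (PNode ts) u -> exists us vs,
  List.Forall2 tiso ts us /\ Permutation.Permutation us vs /\ u = PNode vs.
Proof. by move=> tu; inversion tu as [ts' us vs F P]; exists us, vs. Qed.

Lemma tiso_refl t : tiso t t.
Proof.
elim/ptree_nested_ind: t => ts IH.
apply: (TIso (us := ts)); last exact: Permutation.Permutation_refl.
by elim: IH => [|t us]; constructor.
Qed.

Definition otiso (o o' : option ptree) : Prop :=
  match o, o' with
  | Some t, Some u => tiso t u
  | None, None => True
  | _, _ => False
  end.

Lemma otiso_refl o : otiso o o. Proof. by case: o => //= t; apply: tiso_refl. Qed.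

Lemma tiso_pmap l l' : List.Forall2 otiso l l' ->
  tiso (PNode (pmap id l)) (PNode (pmap id l')).
Proof.
move=> H; apply: (TIso (us := pmap id l')); last exact: Permutation.Permutation_refl.
by elim: H => [|[t|] [u|] us vs] //=; constructor.
Qed.

Lemma tiso_pmap_perm l l' : Permutation.Permutation l l' ->
  tiso (PNode (pmap id l)) (PNode (pmap id l')).
Proof.
move=> H; apply: (TIso (us := pmap id l)).
  by elim: (pmap id l) => [|t us]; constructor => //; apply: tiso_refl.
elim: H => [|[t|] us vs _|[t|] [u|] us|us vs ws _ H1 _ H2] //=;
 try by constructor.
by apply: Permutation.perm_trans H1 H2.
Qed.

Section Invariance.
Variable R : realType.
Local Notation C := R[i].

Definition invariant (h : ptree -> C) : Prop := forall t u, tiso t u -> h t = h u.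
Definition oinvariant (h : option ptree -> C) : Prop :=
  forall o o', otiso o o' -> h o = h o'.

Variable (a : ptree -> C).
Hypothesis a_inv : invariant a.
Let w (l : seq ptree) : C := \prod_(t <- l) a t.

Section Choices.
Variable f : ptree -> seq (option ptree * seq ptree).
(** [H] may depend on the whole list of root parts, since peeling off one child turns [H] into its
    partial application to the part chosen there. *)
Let S (H : seq (option ptree) -> C) ts : C :=
  \sum_(c <- choices (map f ts)) H (map fst c) * \prod_(x <- c) w x.2.

Let S_cons H t ts :
  S H (t :: ts) = \sum_(x <- f t) w x.2 * S (fun l => H (x.1 :: l)) ts.
Proof.
rewrite /S /= big_allpairs_dep; apply: eq_bigr => x _.
rewrite big_distrr /=; apply: eq_bigr => c _.
by rewrite big_cons /= mulrCA.
Qed.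

Let S_forall2 ts us H :
  List.Forall2 (fun t u => forall h, oinvariant h ->
    \sum_(x <- f t) h x.1 * w x.2 = \sum_(x <- f u) h x.1 * w x.2) ts us ->
  (forall l l', List.Forall2 otiso l l' -> H l = H l') -> S H ts = S H us.
Proof.
move=> F; elim: F H => [|t u {}ts {}us ftu _ IH] H Hinv //.
rewrite !S_cons; under eq_bigr do rewrite mulrC.
under [RHS]eq_bigr do rewrite mulrC.
(* Replace the head child first, taking the sum over its siblings as the weight [h]; then replace
   the siblings by induction. *)
transitivity (\sum_(x <- f u) S (fun l => H (x.1 :: l)) ts * w x.2).
  apply: (ftu (fun o => S (fun l => H (o :: l)) ts)) => o o' oo'.
  apply: eq_bigr => c _; congr (_ * _); apply: Hinv; constructor => //.
  by elim: (map fst c) => [|o1 l]; constructor => //; apply: otiso_refl.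
apply: eq_bigr => x _; congr (_ * _); apply: IH => l l' ll'.
by apply: Hinv; constructor => //; apply: otiso_refl.
Qed.

Let S_perm ts us H : Permutation.Permutation ts us ->
  (forall l l', Permutation.Permutation l l' -> H l = H l') -> S H ts = S H us.
Proof.
move=> P; elim: P H => [|t {}ts {}us _ IH|t u {}ts|{}ts {}us vs _ IH1 _ IH2] H Hinv //.
- rewrite !S_cons; apply: eq_bigr => x _; congr (_ * _); apply: IH => l l' ll'.
  by apply: Hinv; constructor.
- rewrite !S_cons; under eq_bigr do rewrite S_cons big_distrr.
  under [RHS]eq_bigr do rewrite S_cons big_distrr.
  rewrite exchange_big; apply: eq_bigr => x _; apply: eq_bigr => y _.
  rewrite /= mulrCA; congr (_ * (_ * _)); apply: eq_bigr => c _; congr (_ * _).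
  by apply: Hinv; constructor.
- by rewrite IH1 // IH2.
Qed.

Lemma choices_sum_invariant (h : ptree -> C) ts us vs : invariant h ->
  List.Forall2 (fun t u => forall h, oinvariant h ->
    \sum_(x <- f t) h x.1 * w x.2 = \sum_(x <- f u) h x.1 * w x.2) ts us ->
  Permutation.Permutation us vs ->
  \sum_(c <- choices (map f ts)) h (PNode (pmap (fun q => q.1) c)) *
     w (flatten (map (fun q => q.2) c))
  = \sum_(c <- choices (map f vs)) h (PNode (pmap (fun q => q.1) c)) *
     w (flatten (map (fun q => q.2) c)).
Proof.
move=> hinv F P.
pose H l := h (PNode (pmap id l)).
have E xs : \sum_(c <- choices (map f xs)) h (PNode (pmap (fun q => q.1) c)) *
     w (flatten (map (fun q => q.2) c)) = S H xs.
  apply: eq_bigr => c _; congr (_ * _).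
    by rewrite /H; congr (h (PNode _)); elim: c => //= x c ->.
  by rewrite /w big_flatten big_map.
rewrite !E (@S_forall2 _ us).
- apply: S_perm => // l l' ll'; apply: hinv; exact: tiso_pmap_perm.
- exact: F.
- by move=> l l' ll'; apply: hinv; apply: tiso_pmap.
Qed.
End Choices.

Lemma Forall_Forall2 (P : ptree -> Prop) (Q Q' : ptree -> ptree -> Prop) ts us :
  List.Forall P ts -> (forall t u, P t -> Q t u -> Q' t u) ->
  List.Forall2 Q ts us -> List.Forall2 Q' ts us.
Proof.
move=> H PQ F; elim: F H => [|t u xs ys q _ IH] H; constructor.
  by apply: PQ q; inversion H.
by apply: IH; inversion H.
Qed.

(** The weight [h] is arbitrary because, seen from the parent, the part chosen in one child is
    weighted by a function of the parts chosen in its siblings. *)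
Lemma ost_sum_invariant t u (h : option ptree -> C) : oinvariant h -> tiso t u ->
  \sum_(p <- ost t) h p.1 * w p.2 = \sum_(p <- ost u) h p.1 * w p.2.
Proof.
elim/ptree_nested_ind: t u h => ts IH u h hinv tu.
have atu := a_inv tu.
have [us [vs [F [P eu]]]] := tiso_node tu; subst u.
rewrite /= !big_cons !big_map /= /w !big_seq1 atu; congr (_ + _).
apply: (@choices_sum_invariant ost (fun t => h (Some t))) P.
  by move=> t1 u1 tu1; apply: hinv.
by apply: Forall_Forall2 IH _ F => t1 u1 H H1 h1 hi; apply: H.
Qed.

Lemma cuts_sum_invariant t u (h : ptree -> C) : invariant h -> tiso t u ->
  \sum_(p <- cuts t) h p.1 * w p.2 = \sum_(p <- cuts u) h p.1 * w p.2.
Proof.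
elim/ptree_nested_ind: t u h => ts IH u h hinv tu.
have [us [vs [F [P eu]]]] := tiso_node tu; subst u.
rewrite !cuts_node !big_map /=.
apply: (choices_sum_invariant hinv) P.
apply: Forall_Forall2 IH _ F => t1 u1 H tu1 h1 hi.
(* A kept edge passes the root component to the parent, a removed edge yields the factor [a p.1].
   Both cases merge into one weight on the root component, to which the induction hypothesis
   applies. *)
have E x : \sum_(y <- cut_choices x) h1 y.1 * w y.2 =
  \sum_(p <- cuts x) (h1 (Some p.1) + h1 None * a p.1) * w p.2.
  rewrite /cut_choices big_flatten big_map; apply: eq_bigr => p _.
  by rewrite big_cons big_seq1 /= {2}/w big_cons mulrA mulrDl.
rewrite !E; apply: (H u1 (fun r => h1 (Some r) + h1 None * a r)) => // x y xy.
congr (_ + _ * _); last exact: a_inv.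
exact: hi.
Qed.
End Invariance.

(** * The inductive limit topology *)

Lemma tsize_tiso t u : tiso t u -> tsize t = tsize u.
Proof.
elim/ptree_nested_ind: t u => ts IH u tu.
have [us [vs [F [P eu]]]] := tiso_node tu; subst u; congr _.+1.
transitivity (sumn (map tsize us)).
  elim: F IH => [|t u xs ys tu' _ IHF] // IH.
  rewrite -[LHS]/(tsize t + sumn (map tsize xs))%N.
  by rewrite (IHF (List.Forall_inv_tail IH)) (List.Forall_inv IH _ tu').
elim: P => [|x l l' _ IHP|x y l|l l' l'' _ IH1 _ IH2] //=; first by rewrite IHP.
  by rewrite addnCA.
by rewrite IH1.
Qed.

Definition slow (kap : nat -> nat) : Prop :=
  {homo kap : m n / (m <= n)%N} /\
  forall k, exists N, forall n, (N <= n)%N -> (k <= kap n)%N.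

Lemma slow_below (M : nat -> nat) :
  exists kap, slow kap /\ forall n, kap n = 0%N \/ (M (kap n) <= n)%N.
Proof.
(* The largest j <= n with M j <= n, or 0 if there is none: a generalized inverse of [M]. *)
pose kap n := \max_(j < n.+1 | (M j <= n)%N) (j : nat).
exists kap; split; [split|].
- move=> m n mn; apply/bigmax_leqP => j Mj.
  have jn : (j < n.+1)%N by apply: leq_trans (ltn_ord j) _.
  by apply: (bigop.bigmax_sup (Ordinal jn)) => //=; apply: leq_trans mn.
- move=> k; exists (maxn k (M k)) => n; rewrite geq_max => /andP[kn Mk].
  have kn1 : (k < n.+1)%N by [].
  exact: (bigop.bigmax_sup (Ordinal kn1)).
- move=> n; rewrite /kap.
  elim/big_ind: _ => [|x y Hx Hy|i Mi]; [by left| |by right].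
  by case: (leqP x y).
Qed.

Section Topology.
Variable R : realType.
Local Notation C := R[i].
Local Notation p2 n := ((2%:R : C) ^+ n).

Lemma p2_gt0 n : 0 < p2 n. Proof. by rewrite exprn_gt0 // ltr0n. Qed.
Lemma p2_ge0 n : 0 <= p2 n. Proof. exact: ltW (p2_gt0 n). Qed.
Lemma p2_ge1 n : 1 <= p2 n. Proof. by rewrite exprn_ege1 // ler1n. Qed.
Lemma p2_le m n : (m <= n)%N -> p2 m <= p2 n.
Proof. by move=> mn; apply: ler_weXn2l; rewrite // ler1n. Qed.

Lemma norm_halves : `|2^-1 : C| + `|2^-1 : C| <= 1.
Proof.
rewrite ger0_norm ?invr_ge0 ?ler0n //.
by have -> : (2^-1 + 2^-1 : C) = 1 by field.
Qed.

Lemma le_p2 (c : C) : 0 <= c -> exists N, c <= p2 N.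
Proof.
(* A nonnegative element of [R[i]] has zero imaginary part, so the archimedean property of [R]
   applies. *)
case: c => a b; rewrite lecE /= => /andP[/eqP -> a0].
exists (Num.bound a).
have -> : p2 (Num.bound a) = ((2%:R : R) ^+ Num.bound a)%:C%C.
  by rewrite rmorphXn /= rmorph_nat.
rewrite lecR; apply: le_trans (ltW (archi_boundP a0)) _.
by rewrite -natrX ler_nat ltnW // ltn_expl.
Qed.

Lemma ge_p2V (e : C) : 0 < e -> exists N, 1 <= e * p2 N.
Proof.
move=> e0; have [N HN] := @le_p2 e^-1 (ltW (etrans (invr_gt0 e) e0)).
by exists N; rewrite -ler_pdivrMl // mulr1.
Qed.

Lemma MsetP (a : tfun R) : Mset a <->
  iso_inv a /\ exists c k, forall t, `|a t| <= p2 (c + k * osize t).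
Proof.
split=> -[ai].
  case=> k [c Hc]; split=> //.
  have [N HN] : exists N, c <= p2 N.
    apply: le_p2; apply: le_trans (Hc None).
    by rewrite divr_ge0 // p2_ge0.
  exists N, k => t; rewrite exprD -ler_pdivrMr ?p2_gt0 //.
  exact: le_trans (Hc t) HN.
case=> c [k H]; split=> //; exists k, (p2 c) => t.
by rewrite ler_pdivrMr ?p2_gt0 // -exprD.
Qed.

(** The constant factor allowed in [MsetP] moves into the exponential rate: a nonempty tree has at
    least one vertex, and the value at the empty tree is 0. *)
Lemma MstarP (a : tfun R) : Mstar a <->
  [/\ iso_inv a, a None = 0 & exists m, forall t, `|a t| <= p2 (m * osize t)].
Proof.
split; last first.
  by case=> ai a0 [m Hm]; split=> //; apply/MsetP; split=> //; exists 0%N, m.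
case=> /MsetP[ai [c [k H]]] a0; split=> //; exists (c + k)%N => -[t|]; last first.
  by rewrite a0 normr0 p2_ge0.
apply: le_trans (H _) _; apply: p2_le => /=; have := tsize_gt0 t; nia.
Qed.

Lemma Mset_lin (l m : C) (a b : tfun R) : Mset a -> Mset b ->
  Mset (tadd (tscale l a) (tscale m b)).
Proof.
move=> /MsetP[ai [c [k Ha]]] /MsetP[bi [d [k' Hb]]]; apply/MsetP; split.
  by move=> t u tu; rewrite /tadd /tscale (ai _ _ tu) (bi _ _ tu).
have [N HN] := le_p2 (normr_ge0 l); have [N' HN'] := le_p2 (normr_ge0 m).
exists (N + N' + c + d + 1)%N, (k + k')%N => t; rewrite /tadd /tscale.
apply: le_trans (ler_normD _ _) _; rewrite !normrM.
apply: (@le_trans _ _ (p2 (N + (c + k * osize t)) + p2 (N' + (d + k' * osize t)))).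
  by rewrite !(exprD _ N) !(exprD _ N') lerD // ler_pM.
apply: (@le_trans _ _ (p2 (N + N' + c + d + (k + k') * osize t) *+ 2)).
  by rewrite mulr2n lerD // p2_le //; nia.
by rewrite -mulr_natr -exprSr p2_le //; nia.
Qed.

Lemma Mset_scale (l : C) (a : tfun R) : Mset a -> Mset (tscale l a).
Proof.
move=> Ma; have -> : tscale l a = tadd (tscale l a) (tscale 0 a).
  by apply/funext => t; rewrite /tadd /tscale; ring.
exact: Mset_lin.
Qed.

Lemma Mstar_lin (l m : C) (a b : tfun R) : Mstar a -> Mstar b ->
  Mstar (tadd (tscale l a) (tscale m b)).
Proof.
move=> [Ma a0] [Mb b0]; split; first exact: Mset_lin.
by rewrite /tadd /tscale a0 b0 !mulr0 addr0.
Qed.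

Lemma Mset_restrict (p : pred nat) (a : tfun R) : Mset a ->
  Mset (fun t => if p (osize t) then a t else 0).
Proof.
move=> /MsetP[ai [c [k Ha]]]; apply/MsetP; split.
  by move=> t u tu /=; rewrite (tsize_tiso tu) (ai _ _ tu).
by exists c, k => t; case: ifP => // _; rewrite normr0 p2_ge0.
Qed.

(* The boxes [|a t| <= 2^(kap |t| * |t| - D)] with [kap] nondecreasing and
   unbounded form a base of neighbourhoods of 0. Writing a_n for the part of a on trees of
   size n and r_n = 2^n (a_n + a_{n+1} + ...), one has
   r_n = (2^{n+1} a_n + r_{n+1}) / 2, where each 2^{n+1} a_n lies in V by the
   size of the box, and r_N lies in V for large N because a lies in some step. *)
Lemma nbhd0_box (V : tfun R -> Prop) (K : nat) : nbhd0 V ->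
  exists D kap, slow kap /\ forall a, Mset a ->
    (forall t, `|a t| * p2 D <= p2 ((K + kap (osize t)) * osize t)) -> V a.
Proof.
move=> [Vconv Vball].
have [E HE] : {E : nat -> nat & forall k a, Mset a ->
    (forall t, `|a t| * p2 (E k) <= p2 (k * osize t)) -> V a}.
  apply: (@choice _ _ (fun k N => forall a, Mset a ->
    (forall t, `|a t| * p2 N <= p2 (k * osize t)) -> V a)) => k.
  have [e [e0 He]] := Vball k; have [N HN] := ge_p2V e0.
  exists N => a Ma Ha; apply: He => // t.
  rewrite ler_pdivrMr ?p2_gt0 //.
  apply: le_trans (ler_wpM2l (ltW e0) (Ha t)).
  by rewrite mulrCA ler_peMr.
(* Scaling by 2^(n+1) and entering V through step K + kap n + 2 cost the exponent n + 1 + E (K + kap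
   n + 2). If the last term is at most n, the summand 2 in the rate and one unit of D pay for this;
   if kap n = 0, D contains E (K + 2). *)
have [kap [skap Hkap]] := slow_below (fun j => E (K + j + 2)%N).
exists (E (K + 2)%N).+1, kap; split=> // a Ma Ha.
pose cut n : tfun R := fun t => if (n <= osize t)%N then a t else 0.
pose part n : tfun R := fun t => if osize t == n then a t else 0.
pose r n := tscale (p2 n) (cut n).
have cutM n : Mset (cut n) by apply: (@Mset_restrict (fun i => n <= i)%N).
have partM n : Mset (part n) by apply: (@Mset_restrict (fun i => i == n)%N).
have rE n : r n = tadd (tscale 2^-1 (tscale (p2 n.+1) (part n))) (tscale 2^-1 (r n.+1)).
  apply/funext => t; rewrite /r /tadd /tscale /cut /part exprS.
  by case: (ltngtP n (osize t)) => _; field.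
have Vpart n : V (tscale (p2 n.+1) (part n)).
  apply: (HE (K + kap n + 2)%N); first exact: Mset_scale.
  move=> t; rewrite /tscale /part; case: eqP => [tn|_]; last first.
    by rewrite mulr0 normr0 mul0r p2_ge0.
  rewrite normrM ger0_norm ?p2_ge0 //.
  have le : (n.+1 + E (K + kap n + 2) <= (E (K + 2)).+1 + 2 * n)%N.
    by case: (Hkap n) => [->|]; [rewrite addn0|]; lia.
  rewrite mulrAC -exprD mulrC.
  apply: le_trans (ler_wpM2l (normr_ge0 _) (p2_le le)) _.
  rewrite exprD mulrA mulnDl tn exprD ler_pM2r ?p2_gt0 // -tn; exact: Ha.
have Vr N n : V (r (n + N)%N) -> V (r N).
  elim: n => // n IH Vn; apply: IH; rewrite rE.
  apply: Vconv => //; try by apply: Mset_scale.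
  exact: norm_halves.
have -> : a = r 0%N by apply/funext => t; rewrite /r /tscale /cut mul1r.
have [_ [c [m Hm]]] := (MsetP a).1 Ma.
(* With N = c + E (m + 2), the tail sees only trees with |t| >= N. There the scaling 2^N and the
   constants c and E (m + 2) have total exponent 2N <= 2|t|. *)
apply: (Vr _ (c + E (m + 2))%N); rewrite addn0; apply: (HE (m + 2)%N).
  exact: Mset_scale.
move=> t; rewrite /r /tscale /cut; case: ifP => [le|_]; last first.
  by rewrite mulr0 normr0 mul0r p2_ge0.
rewrite normrM ger0_norm ?p2_ge0 // mulrAC -exprD mulrC.
apply: le_trans (ler_wpM2r (p2_ge0 _) (Hm t)) _.
rewrite -exprD; apply: p2_le; lia.
Qed.

Lemma box_nbhd0 (D : nat) (kap : nat -> nat) : slow kap ->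
  nbhd0 (fun a : tfun R => forall t, `|a t| * p2 D <= p2 (kap (osize t) * osize t)).
Proof.
move=> [kmon kinf]; split.
  move=> a b l m _ _ Ha Hb lm t; rewrite /tadd /tscale.
  apply: (@le_trans _ _ ((`|l| + `|m|) * p2 (kap (osize t) * osize t))); last first.
    by rewrite ler_piMl // p2_ge0.
  apply: le_trans (ler_wpM2r (p2_ge0 _) (ler_normD _ _)) _.
  by rewrite !normrM !mulrDl -!mulrA lerD // ler_wpM2l.
move=> k; have [N HN] := kinf k.
(* For |t| >= N the rate [kap] is already at least k; for smaller trees the factor 2^(-kN)
   compensates 2^(k|t|). *)
exists (p2 (D + k * N))^-1; split; first by rewrite invr_gt0 p2_gt0.
move=> a _ Ha t; have := Ha t.
rewrite ler_pdivrMr ?p2_gt0 // ler_pdivlMl ?p2_gt0 // => H.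
rewrite -(ler_pM2l (p2_gt0 (k * N))).
apply: (@le_trans _ _ (p2 (k * osize t))).
  by move: H; rewrite exprD; congr (_ <= _); ring.
rewrite -exprD; apply: p2_le.
case: (leqP N (osize t)) => [/HN|]; nia.
Qed.

Lemma nbhd0_half (V : tfun R -> Prop) : nbhd0 V -> nbhd0 (fun v => V (tscale 2%:R v)).
Proof.
move=> [Vconv Vball]; split.
  move=> a b l m Ma Mb Va Vb lm.
  have -> : tscale 2%:R (tadd (tscale l a) (tscale m b)) =
     tadd (tscale l (tscale 2%:R a)) (tscale m (tscale 2%:R b)).
    by apply/funext => t; rewrite /tadd /tscale; ring.
  by apply: Vconv => //; apply: Mset_scale.
move=> k; have [e [e0 He]] := Vball k; exists (e / 2%:R); split.
  by rewrite divr_gt0 // ltr0n.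
move=> a Ma Ha; apply: He => [|t]; first exact: Mset_scale.
by rewrite /tscale normrM normr_nat -mulrA mulrC -ler_pdivlMr ?ltr0n.
Qed.

Lemma nbhd0_zero (V : tfun R -> Prop) : nbhd0 V -> V (fun=> 0).
Proof.
move=> [_ /(_ 0%N) [e [e0 He]]]; apply: He => [|t].
  by apply/MsetP; split=> //; exists 0%N, 0%N => t; rewrite normr0 p2_ge0.
by rewrite normr0 mul0r ltW.
Qed.

(** The interior of an arbitrary set is open because V/2 + V/2 lies in V by convexity: V/2 witnesses
    openness at y, and again interiority at each nearby point. *)
Lemma interior_open (N : tfun R -> Prop) :
  @popen R (MstarSpace R) (fun y => exists V, nbhd0 V /\
    forall v, Mstar v -> V v -> N (tadd y v)).
Proof.
move=> y My [V [NV HV]]; exists (fun v => V (tscale 2%:R v)).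
split; first exact: nbhd0_half.
move=> v Mv Vv; exists (fun v => V (tscale 2%:R v)); split; first exact: nbhd0_half.
move=> w Mw Vw.
have -> : tadd (tadd y v) w = tadd y (tadd v w).
  by apply/funext => t; rewrite /tadd addrA.
have E : tadd v w = tadd (tscale 2^-1 (tscale 2%:R v)) (tscale 2^-1 (tscale 2%:R w)).
  by apply/funext => t; rewrite /tadd /tscale; field.
apply: HV; rewrite E.
  have S2 u : Mstar u -> Mstar (tscale (2%:R : C) u).
    by case=> Mu u0; split; [apply: Mset_scale|rewrite /tscale u0 mulr0].
  by apply: Mstar_lin; apply: S2.
case: NV => Vconv _; apply: Vconv => //; try by apply: Mset_scale; case: Mv Mw => [? _] [? _].
exact: norm_halves.
Qed.

Lemma box_open (D : nat) (kap : nat -> nat) (x : tfun R) : slow kap -> Mstar x ->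
  exists A, [/\ @popen R (MstarSpace R) A, A x & forall y, A y ->
    forall t, `|y t - x t| * p2 D <= p2 (kap (osize t) * osize t)].
Proof.
move=> sk Mx.
exists (fun y => exists V, nbhd0 V /\ forall v, Mstar v -> V v ->
  forall t, `|tadd y v t - x t| * p2 D <= p2 (kap (osize t) * osize t)).
split; first by apply: (@interior_open (fun y =>
  forall t, `|y t - x t| * p2 D <= p2 (kap (osize t) * osize t))).
  exists (fun v => forall t, `|v t| * p2 D <= p2 (kap (osize t) * osize t)).
  split; first exact: box_nbhd0.
  by move=> v _ Hv t; rewrite /tadd addrAC subrr add0r.
move=> y [V [NV H]] t; have := H (fun=> 0) _ (nbhd0_zero NV) t.
rewrite /tadd addr0; apply.
by apply/MstarP; split=> //; exists 0%N => u; rewrite normr0 p2_ge0.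
Qed.
End Topology.

(** * Tame polynomial families *)

(* Iterated derivatives live on E, E x E, (E x E) x (E x E), ... with E = M* or
   M* x M*; a shape records such an iterated product [spc s] of copies of M*, and
   [var s] indexes its factors. *)
Inductive shape := Leaf | Pair of shape & shape.

Section Families.
Variable R : realType.
Local Notation C := R[i].
Local Notation p2 n := ((2%:R : C) ^+ n).

Fixpoint spc (s : shape) : space R :=
  match s with
  | Leaf => MstarSpace R
  | Pair s1 s2 => pspace (spc s1) (spc s2)
  end.

Fixpoint var (s : shape) : Type :=
  match s with
  | Leaf => unit
  | Pair s1 s2 => (var s1 + var s2)%type
  end.

Fixpoint ev (s : shape) : var s -> pt (spc s) -> tfun R :=
  match s return var s -> pt (spc s) -> tfun R with
  | Leaf => fun _ x => x
  | Pair s1 s2 => fun v x =>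
      match v with inl u => ev u x.1 | inr u => ev u x.2 end
  end.

Lemma Mstar_axpy (l : C) (a b : tfun R) : Mstar a -> Mstar b ->
  Mstar (tadd a (tscale l b)).
Proof.
move=> Ma Mb; have -> : a = tscale 1 a by apply/funext => t; rewrite /tscale mul1r.
exact: Mstar_lin.
Qed.

Lemma pdom_axpy s (l : C) (x h : pt (spc s)) : @pdom _ (spc s) x -> @pdom _ (spc s) h ->
  @pdom _ (spc s) (padd x (pscale l h)).
Proof.
elim: s x h => [|s1 IH1 s2 IH2] /= x h; first exact: Mstar_axpy.
by move=> [x1 x2] [h1 h2]; split; [apply: IH1|apply: IH2].
Qed.

Lemma ev_axpy s (v : var s) (l : C) (x h : pt (spc s)) :
  ev v (padd x (pscale l h)) = tadd (ev v x) (tscale l (ev v h)).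
Proof. by elim: s v x h => [|s1 IH1 s2 IH2] //= [v|v] x h; rewrite ?IH1 ?IH2. Qed.

Lemma ev_bound s (x : pt (spc s)) : @pdom _ (spc s) x ->
  exists m, forall (v : var s) t, `|ev v x t| <= p2 (m * osize t).
Proof.
elim: s x => [|s1 IH1 s2 IH2] /= x.
  by case/MstarP=> _ _ [m Hm]; exists m.
case=> /IH1 [m1 H1] /IH2 [m2 H2]; exists (m1 + m2)%N => -[v|v] t.
  by apply: le_trans (H1 v t) _; apply: p2_le; nia.
by apply: le_trans (H2 v t) _; apply: p2_le; nia.
Qed.

Lemma ev_box s (D : nat) (kap : nat -> nat) (x : pt (spc s)) : slow kap ->
  @pdom _ (spc s) x -> exists A, [/\ @popen _ (spc s) A, A x & forall y, A y ->
    forall (v : var s) t,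
      `|ev v y t - ev v x t| * p2 D <= p2 (kap (osize t) * osize t)].
Proof.
move=> sk; elim: s x => [|s1 IH1 s2 IH2] /= x.
  by case/(box_open D sk) => A [oA Ax HA]; exists A; split=> // y /HA H _.
case=> /IH1 [A [oA Ax HA]] /IH2 [B [oB Bx HB]].
exists (fun p => A p.1 /\ B p.2); split=> //.
  by move=> y z _ _ [Ay Bz]; exists A, B.
by move=> y [/HA H1 /HB H2] [v|v] t.
Qed.

(* A monomial is a product of coordinates, one for each (factor, tree) in the list. *)
Definition mono s : Type := seq (var s * ptree).

Definition mval s (mu : mono s) (x : pt (spc s)) : C :=
  \prod_(v <- mu) ev v.1 x (Some v.2).

Lemma mval_cons s v (mu : mono s) x :
  mval (v :: mu) x = ev v.1 x (Some v.2) * mval mu x.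
Proof. exact: big_cons. Qed.

Definition mweight s (mu : mono s) : nat := sumn (map (fun v => tsize v.2) mu).

Definition fam s : Type := ptree -> seq (C * mono s).

Definition fval s (P : fam s) (x : pt (spc s)) : tfun R := fun o =>
  match o with
  | None => 0
  | Some t => \sum_(q <- P t) q.1 * mval q.2 x
  end.

Definition tame_by s (K : nat) (P : fam s) : Prop := forall t,
  all (fun q => mweight q.2 <= tsize t)%N (P t) /\
  \sum_(q <- P t) `|q.1| <= p2 (K * tsize t).

(** Invariance is imposed on values and not on the lists of monomials, which differ between
    isomorphic planar trees. *)
Definition iso_fam s (P : fam s) : Prop :=
  forall x, @pdom _ (spc s) x -> iso_inv (fval P x).

(** The common estimate behind boundedness, continuity and differentiability: [F] will be the value,
    the increment and the second order remainder of a monomial. *)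
Lemma tame_sum s K (P : fam s) (F : mono s -> C) (b : C) t : tame_by K P ->
  0 <= b -> (forall mu, (mweight mu <= tsize t)%N -> `|F mu| <= b) ->
  `|\sum_(q <- P t) q.1 * F q.2| <= p2 (K * tsize t) * b.
Proof.
move=> /(_ t) [Pw Pn] b0 Fb.
apply: (@le_trans _ _ ((\sum_(q <- P t) `|q.1|) * b)); last exact: ler_wpM2r.
elim: (P t) Pw {Pn} => [|q l IH] /=; first by rewrite !big_nil normr0 mul0r.
case/andP=> /Fb qb /IH lb; rewrite !big_cons mulrDl.
by apply: le_trans (ler_normD _ _) _; rewrite normrM lerD // ler_wpM2l.
Qed.

(** A factor 2 costs one unit of rate, because there is at least one vertex to charge it to. *)
Lemma p2_double m n : (0 < n)%N -> p2 (m * n) + p2 (m * n) <= p2 (m.+1 * n).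
Proof.
move=> n0; have -> : p2 (m * n) + p2 (m * n) = p2 (m * n).+1 by rewrite exprS; ring.
apply: p2_le; nia.
Qed.

Lemma mval_bound s (mu : mono s) x m :
  (forall (v : var s) t, `|ev v x t| <= p2 (m * osize t)) ->
  `|mval mu x| <= p2 (m * mweight mu).
Proof.
move=> H; rewrite /mval /mweight; elim: mu => [|v mu IH] /=.
  by rewrite big_nil normr1 muln0.
by rewrite big_cons normrM mulnDr exprD ler_pM // (H v.1 (Some v.2)).
Qed.

Lemma fval_Mstar s K (P : fam s) x : tame_by K P -> iso_fam P ->
  @pdom _ (spc s) x -> Mstar (fval P x).
Proof.
move=> tP iP dx; apply/MstarP; split=> //; first exact: iP.
have [m Hm] := ev_bound dx.
exists (K + m)%N => -[t|] /=; last by rewrite normr0 p2_ge0.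
rewrite mulnDl exprD; apply: (tame_sum (F := fun mu => mval mu x)) => //.
  exact: p2_ge0.
move=> mu mut; apply: le_trans (mval_bound mu Hm) _.
by apply: p2_le; rewrite leq_mul2l mut orbT.
Qed.

Lemma mval_diff s (mu : mono s) x y (D m k n : nat) :
  (forall (v : var s) t, `|ev v x t| <= p2 (m * osize t)) ->
  (forall (v : var s) t, (osize t <= n)%N ->
     `|ev v y t - ev v x t| * p2 D <= p2 (k * osize t)) ->
  (mweight mu <= n)%N ->
  `|mval mu y - mval mu x| * p2 D <= p2 ((m + k).+1 * mweight mu).
Proof.
(* The telescoping y0 Y0 - x0 X0 = (y0 - x0) Y0 + x0 (Y0 - X0) needs a bound on the value at y as
   well, so both are proved together. *)
move=> Hx Hyx; suff H : (mweight mu <= n)%N ->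
    `|mval mu y| <= p2 ((m + k).+1 * mweight mu) /\
    `|mval mu y - mval mu x| * p2 D <= p2 ((m + k).+1 * mweight mu).
  by case/H.
rewrite /mweight; elim: mu => [|[v t] mu IH] /=.
  by rewrite /mval !big_nil subrr normr0 normr1 mul0r muln0; split.
move=> le; have [|Y YX] := IH; first by lia.
rewrite !mval_cons /=.
have tn : (osize (Some t) <= n)%N by rewrite /=; lia.
have := Hx v (Some t); have := Hyx v (Some t) tn.
set y0 := ev v y _; set x0 := ev v x _.
set Y0 := mval mu y in Y YX *; set X0 := mval mu x in YX *.
set w := (sumn _) in le Y YX *; rewrite /= => yx0 xb.
have sumle : p2 (k * tsize t) + p2 (m * tsize t) <= p2 ((m + k).+1 * tsize t).
  apply: le_trans (p2_double _ (tsize_gt0 t)).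
  by apply: lerD; apply: p2_le; nia.
split.
  rewrite normrM mulnDr exprD ler_pM //; apply: le_trans sumle.
  have -> : y0 = (y0 - x0) + x0 by rewrite subrK.
  apply: le_trans (ler_normD _ _) (lerD _ xb).
  by apply: le_trans yx0; rewrite ler_peMr // p2_ge1.
have -> : y0 * Y0 - x0 * X0 = (y0 - x0) * Y0 + x0 * (Y0 - X0) by ring.
apply: le_trans (ler_wpM2r (p2_ge0 _ _) (ler_normD _ _)) _.
have -> : (`|(y0 - x0) * Y0| + `|x0 * (Y0 - X0)|) * p2 D =
    (`|y0 - x0| * p2 D) * `|Y0| + `|x0| * (`|Y0 - X0| * p2 D).
  by rewrite !normrM; ring.
rewrite mulnDr exprD; apply: le_trans (ler_wpM2r (p2_ge0 _ _) sumle).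
by rewrite mulrDl; apply: lerD; apply: ler_pM; rewrite // mulr_ge0 // p2_ge0.
Qed.

Lemma fam_cont s K (P : fam s) (f : pt (spc s) -> tfun R) : tame_by K P -> iso_fam P ->
  (forall x, @pdom _ (spc s) x -> f x = fval P x) ->
  @pcont R (spc s) (MstarSpace R) f.
Proof.
move=> tP iP fP x dx B oB; rewrite fP // => Bx.
have MP := fval_Mstar tP iP.
have [V [NV HV]] := oB _ (MP _ dx) Bx.
have [m Hm] := ev_bound dx.
(* The shift of the rate collects K from the coefficients, m from the growth of x, and 1 from the
   doubling in [mval_diff]. *)
have [D [kap [sk HD]]] := nbhd0_box (K + m).+1 NV.
have [A [oA Ax HA]] := ev_box D sk dx.
exists A; split=> //; split=> // y dy Ay; rewrite fP //.
have -> : fval P y = tadd (fval P x) (tadd (fval P y) (tscale (-1) (fval P x))).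
  by apply/funext => t; rewrite /tadd /tscale; ring.
have Md : Mstar (tadd (fval P y) (tscale (-1) (fval P x))).
  by apply: Mstar_axpy; apply: MP.
apply: HV => //; apply: HD; first by case: Md.
case=> [t|]; rewrite /tadd /tscale /=; last first.
  by rewrite mulr0 addr0 normr0 mul0r p2_ge0.
rewrite mulN1r -sumrB; under eq_bigr do rewrite -mulrBr.
rewrite -[X in _ * X]ger0_norm ?p2_ge0 // -normrM big_distrl /=.
under eq_bigr do rewrite -mulrA.
have -> : ((K + m).+1 + kap (tsize t) = K + (m + kap (tsize t)).+1)%N by lia.
rewrite mulnDl exprD.
apply: (tame_sum (F := fun mu => (mval mu y - mval mu x) * p2 D)) => //.
  exact: p2_ge0.
move=> mu mut; rewrite normrM [X in _ * X]ger0_norm ?p2_ge0 //.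
apply: le_trans (_ : p2 ((m + kap (tsize t)).+1 * mweight mu) <= _); last first.
  by apply: p2_le; rewrite leq_mul2l mut orbT.
apply: (mval_diff (n := tsize t)) => // v u ut.
(* Monotonicity of [kap] replaces the rate at each small tree u by the rate at the whole tree t. *)
apply: le_trans (HA _ Ay v u) _; apply: p2_le; rewrite leq_mul2r.
by case: sk => [kmon _]; rewrite kmon ?orbT.
Qed.

(* Leibniz rule: one factor is evaluated at the direction ([inr]), the others at
   the base point ([inl]). *)
Fixpoint dmono s (mu : mono s) : seq (mono (Pair s s)) :=
  match mu with
  | [::] => [::]
  | v :: mu' => ((inr v.1, v.2) :: [seq (inl u.1, u.2) | u <- mu'])
                :: [seq (inl v.1, v.2) :: nu | nu <- dmono mu']
  end.

Definition dmval s (mu : mono s) (x h : pt (spc s)) : C :=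
  \sum_(nu <- dmono mu) mval nu ((x, h) : pt (spc (Pair s s))).

Lemma dmval_cons s v (mu : mono s) x h : dmval (v :: mu) x h =
  ev v.1 h (Some v.2) * mval mu x + ev v.1 x (Some v.2) * dmval mu x h.
Proof.
rewrite /dmval /= big_cons {1}/mval big_cons big_map; congr (_ * _ + _).
rewrite big_map big_distrr /=; apply: eq_bigr => nu _.
by rewrite /mval big_cons.
Qed.

Definition dfam s (P : fam s) : fam (Pair s s) := fun t =>
  flatten [seq [seq (q.1, nu) | nu <- dmono q.2] | q <- P t].

Lemma dfam_val s (P : fam s) (x h : pt (spc s)) t :
  fval (dfam P) ((x, h) : pt (spc (Pair s s))) (Some t) =
  \sum_(q <- P t) q.1 * dmval q.2 x h.
Proof.
rewrite /= /dfam big_flatten big_map; apply: eq_bigr => q _.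
by rewrite big_map big_distrr.
Qed.

Lemma dmono_weight s (mu : mono s) :
  all (fun nu => mweight nu == mweight mu) (dmono mu).
Proof.
elim: mu => [|v mu IH] //=; apply/andP; split.
  by rewrite /mweight /= -map_comp.
by rewrite all_map; apply: sub_all IH => nu /= /eqP; rewrite /mweight /= => ->.
Qed.

Lemma dmono_size s (mu : mono s) : (size (dmono mu) <= mweight mu)%N.
Proof.
elim: mu => [|v mu IH] //=; rewrite size_map /mweight /= -add1n.
by apply: leq_add IH; apply: tsize_gt0.
Qed.

(** The Leibniz rule repeats each coefficient once per factor of its monomial, hence at most |t| <=
    2^|t| times. *)
Lemma dfam_tame s K (P : fam s) : tame_by K P -> tame_by K.+1 (dfam P).
Proof.
move=> tP t; have [Pw Pn] := tP t.
have [H1 H2] : all (fun q => mweight q.2 <= tsize t)%N (dfam P t) /\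
    \sum_(q <- dfam P t) `|q.1| <= (\sum_(q <- P t) `|q.1|) * (tsize t)%:R.
  rewrite /dfam; elim: (P t) Pw {Pn} => [|q l IH] /=.
    by rewrite !big_nil mul0r.
  case/andP=> qt /IH [w n]; rewrite all_cat big_cat big_cons w andbT /= mulrDl; split.
    by rewrite all_map; apply: sub_all (dmono_weight q.2) => nu /= /eqP ->.
  apply: lerD n; rewrite big_map /= big_const_seq count_predT iter_addr_0 -[leLHS]mulr_natr.
  by rewrite ler_wpM2l // ler_nat (leq_trans (dmono_size _)).
split=> //; apply: le_trans H2 _; rewrite mulSn addnC exprD ler_pM //.
  by rewrite sumr_ge0.
by rewrite -natrX ler_nat ltnW // ltn_expl.
Qed.

Lemma mval_remainder s (mu : mono s) x h (l : C) m :
  (forall (v : var s) t, `|ev v x t| <= p2 (m * osize t)) ->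
  (forall (v : var s) t, `|ev v h t| <= p2 (m * osize t)) -> `|l| <= 1 ->
  `|mval mu (padd x (pscale l h)) - mval mu x - l * dmval mu x h|
    <= `|l| ^+ 2 * p2 (m.+1 * mweight mu).
Proof.
move=> Hx Hh l1; set y := padd _ _.
(* Value, first order increment and second order remainder are bounded by one induction, since the
   product rule expresses each through the preceding ones. *)
suff [] : [/\ `|mval mu y| <= p2 (m.+1 * mweight mu),
  `|mval mu y - mval mu x| <= `|l| * p2 (m.+1 * mweight mu) &
  `|mval mu y - mval mu x - l * dmval mu x h| <= `|l| ^+ 2 * p2 (m.+1 * mweight mu)] by [].
elim: mu => [|[v t] mu [Y YX YXD]].
  rewrite /mval /dmval !big_nil mulr0 subr0 subrr normr0 normr1 muln0 mulr1.
  by split=> //; rewrite mulr1 exprn_ge0.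
rewrite dmval_cons !mval_cons [mweight (_ :: _)]/= -/(mweight mu) /=.
rewrite /y ev_axpy -/y /tadd /tscale.
have := Hx v (Some t); have := Hh v (Some t) => /=.
set x0 := ev v x _; set h0 := ev v h _ => hb xb.
move: Y YX YXD.
set Y := mval mu y; set X := mval mu x; set DX := dmval _ _ _ => HY HYX HYXD.
have dbl := p2_double m (tsize_gt0 t).
have lh : `|l * h0| <= p2 (m * tsize t).
  by rewrite normrM; apply: le_trans hb; rewrite ler_piMl.
rewrite mulnDr exprD; split.
- rewrite normrM ler_pM //; apply: le_trans (ler_normD _ _) _.
  by apply: le_trans (lerD xb lh) _.
- have -> : (x0 + l * h0) * Y - x0 * X = x0 * (Y - X) + l * (h0 * Y) by ring.
  apply: le_trans (ler_normD _ _) _; rewrite !normrM.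
  apply: (@le_trans _ _ (`|l| * ((p2 (m * tsize t) + p2 (m * tsize t)) *
      p2 (m.+1 * mweight mu)))).
    rewrite mulrDl mulrDr; apply: lerD; last by rewrite ler_wpM2l // ler_pM.
    by rewrite [leRHS]mulrCA ler_pM.
  by rewrite ler_wpM2l // ler_wpM2r // p2_ge0.
- have -> : (x0 + l * h0) * Y - x0 * X - l * (h0 * X + x0 * DX) =
    x0 * (Y - X - l * DX) + l * (h0 * (Y - X)) by ring.
  apply: le_trans (ler_normD _ _) _; rewrite !normrM.
  apply: (@le_trans _ _ (`|l| ^+ 2 * ((p2 (m * tsize t) + p2 (m * tsize t)) *
      p2 (m.+1 * mweight mu)))).
    rewrite mulrDl mulrDr; apply: lerD; first by rewrite [leRHS]mulrCA ler_pM.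
    rewrite expr2 -mulrA ler_wpM2l // [leRHS]mulrCA ler_pM //.
  by rewrite ler_wpM2l ?exprn_ge0 // ler_wpM2r // p2_ge0.
Qed.

(** The rate m is chosen before t and l, so the whole remainder lies in one Banach step with norm at
    most |l|^2. *)
Lemma fval_remainder s K (P : fam s) x h : tame_by K P ->
  @pdom _ (spc s) x -> @pdom _ (spc s) h ->
  exists m, forall t (l : C), `|l| <= 1 ->
  `|fval P (padd x (pscale l h)) t - fval P x t -
    l * fval (dfam P) ((x, h) : pt (spc (Pair s s))) t|
  <= `|l| ^+ 2 * p2 (m * osize t).
Proof.
move=> tP dx dh; have [m1 H1] := ev_bound dx; have [m2 H2] := ev_bound dh.
have Hx (v : var s) t : `|ev v x t| <= p2 ((m1 + m2) * osize t).
  by apply: le_trans (H1 v t) _; apply: p2_le; nia.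
have Hh (v : var s) t : `|ev v h t| <= p2 ((m1 + m2) * osize t).
  by apply: le_trans (H2 v t) _; apply: p2_le; nia.
exists (K + (m1 + m2).+1)%N => -[t|] l l1; last first.
  by rewrite /= mulr0 !subr0 normr0 mulr_ge0 ?exprn_ge0 ?p2_ge0.
rewrite dfam_val.
have -> : fval P (padd x (pscale l h)) (Some t) - fval P x (Some t) -
    l * \sum_(q <- P t) q.1 * dmval q.2 x h =
  \sum_(q <- P t) q.1 * (mval q.2 (padd x (pscale l h)) - mval q.2 x -
    l * dmval q.2 x h).
  by rewrite /= big_distrr -!sumrB /=; apply: eq_bigr => q _; ring.
rewrite mulnDl exprD mulrCA.
apply: (tame_sum (F := fun mu =>
  mval mu (padd x (pscale l h)) - mval mu x - l * dmval mu x h)) => //.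
  by rewrite mulr_ge0 ?exprn_ge0 ?p2_ge0.
move=> mu mut; apply: le_trans (mval_remainder mu Hx Hh l1) _.
by rewrite ler_wpM2l ?exprn_ge0 // p2_le // leq_mul2l mut orbT.
Qed.

(* The derivative inherits isomorphism invariance as a limit of difference quotients. *)
Lemma dfam_iso s K (P : fam s) : tame_by K P -> iso_fam P -> iso_fam (dfam P).
Proof.
move=> tP iP [x h] [dx dh] t u tu.
have [m Hm] := fval_remainder tP dx dh.
move: {Hm} (Hm (Some t)) (Hm (Some u)).
set g := fval (dfam P) _ => Ht Hu.
apply/eqP; rewrite -subr_eq0 -normr_le0; apply/negPn/negP => ne.
have e0 : 0 < `|g (Some t) - g (Some u)|.
  by rewrite normr_gt0; apply: contra ne => /eqP ->; rewrite normr0.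
have [N HN] := ge_p2V e0.
(* With l = 2^(-M), the remainder estimates give 2^M |g t - g u| <= 2b, while this M makes the left
   side at least 4b > 0. *)
set M := (m * osize (Some t) + 2 + N)%N.
pose l : C := (p2 M)^-1.
have l0 : 0 < l by rewrite invr_gt0 p2_gt0.
have l1 : `|l| <= 1 by rewrite gtr0_norm // invf_le1 ?p2_gt0 // p2_ge1.
have {Ht}Ht := Ht _ l1; have {Hu}Hu := Hu _ l1.
rewrite -(iP _ (pdom_axpy l dx dh) _ _ tu) -(iP _ dx _ _ tu) in Hu.
have eo : osize (Some u) = osize (Some t) by rewrite /= (tsize_tiso tu).
rewrite eo in Hu; move: Ht Hu.
set d := _ - fval P x _; set b := p2 (m * _) => Ht Hu.
have H : `|l * (g (Some t) - g (Some u))| <= `|l| ^+ 2 * b + `|l| ^+ 2 * b.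
  have -> : l * (g (Some t) - g (Some u)) =
    (d - l * g (Some u)) - (d - l * g (Some t)) by ring.
  by apply: le_trans (ler_normB _ _) (lerD Hu Ht).
move: H; rewrite normrM gtr0_norm // expr2 -mulrDr -mulrA ler_pM2l //.
rewrite /l ler_pdivlMl ?p2_gt0 // => H.
have : 4%:R * b <= b + b.
  apply: le_trans H; rewrite /M 2!exprD -/b.
  have -> : b * p2 2 * p2 N * `|g (Some t) - g (Some u)| =
    (`|g (Some t) - g (Some u)| * p2 N) * (4%:R * b) by ring.
  by rewrite ler_peMl // mulr_ge0 // ?ler0n // p2_ge0.
have -> : b + b = 2%:R * b by ring.
by rewrite ler_pM2r ?p2_gt0 // ler_nat.
Qed.

(** Shape and rate vary in the induction, as the derivative lives on [Pair s s] with rate [K.+1].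
    The map need agree with its family only on the domain, which matters for multiplication: its
    coordinate at the empty tree must vanish. *)
Lemma fam_Ck k s K (P : fam s) (f : pt (spc s) -> tfun R) :
  tame_by K P -> iso_fam P ->
  (forall x, @pdom _ (spc s) x -> f x = fval P x) ->
  @Ck R k (spc s) (MstarSpace R) f.
Proof.
elim: k s K P f => [|k IH] s K P f tP iP fP; split=> //;
  try exact: (fam_cont tP iP fP).
have tD := dfam_tame tP; have iD := dfam_iso tP iP.
exists (fval (dfam P) : pt (pspace (spc s) (spc s)) -> tfun R); split; last first.
  exact: (IH (Pair s s) K.+1 (dfam P)).
move=> x h dx dh.
have ML : Mstar (fval (dfam P) ((x, h) : pt (spc (Pair s s)))).
  exact: (fval_Mstar tD iD).
split=> // B oB BL.
have [V [[_ Vball] HV]] := oB _ ML BL.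
have [m Hm] := fval_remainder tP dx dh.
(* Only the ball of V in step m is needed: after division by l the remainder has norm at most |l| <
   2^(-N) <= e there. *)
have [e [e0 He]] := Vball m; have [N HN] := ge_p2V e0.
exists (p2 N)^-1; split; first by rewrite invr_gt0 p2_gt0.
move=> l l0 lN; have dy := pdom_axpy l dx dh.
rewrite !fP // /=.
set y := padd x _; set L := fval (dfam P) _ in ML HV Hm *.
have -> : tscale l^-1 (tadd (fval P y) (tscale (-1) (fval P x))) =
  tadd L (tadd (tadd (tscale l^-1 (fval P y)) (tscale (- l^-1) (fval P x)))
    (tscale (-1) L)).
  by apply/funext => t; rewrite /tadd /tscale; ring.
have Mv : Mstar (tadd (tadd (tscale l^-1 (fval P y)) (tscale (- l^-1) (fval P x)))
    (tscale (-1) L)).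
  by apply: Mstar_axpy => //; apply: Mstar_lin; apply: (fval_Mstar tP iP).
apply: HV => //; apply: He => [|t]; first by case: Mv.
have le1 : (p2 N)^-1 <= 1 by rewrite invf_le1 ?p2_gt0 // p2_ge1.
have lpos : 0 < `|l| by rewrite normr_gt0.
rewrite ler_pdivrMr ?p2_gt0 // -(ler_pM2l lpos) -normrM.
have -> : l * (tadd (tadd (tscale l^-1 (fval P y)) (tscale (- l^-1) (fval P x)))
    (tscale (-1) L)) t = fval P y t - fval P x t - l * L t.
  by rewrite /tadd /tscale; field.
apply: le_trans (Hm t l (le_trans (ltW lN) le1)) _.
rewrite expr2 -mulrA ler_pM2l // ler_wpM2r ?p2_ge0 //.
by apply: le_trans (ltW lN) _; rewrite -[leLHS]mul1r ler_pdivrMr ?p2_gt0.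
Qed.

(** * The families of multiplication and inversion *)

(** The second argument ([inr]) is evaluated on the subtree and the first ([inl]) on the remaining
    forest. The empty subtree contributes no factor, because group elements take the value 1
    there. *)
Definition mul_fam : fam (Pair Leaf Leaf) := fun t =>
  [seq (1, (if p.1 is Some r then [:: (inr tt, r)] else [::]) ++
           [seq (inl tt, th) | th <- p.2]) | p <- ost t].

Definition inv_fam : fam Leaf := fun t =>
  [seq ((-1) ^+ (size p.2).+1, (tt, p.1) :: [seq (tt, th) | th <- p.2]) | p <- cuts t].

Lemma tame_count s (P : fam s) :
  (forall t, all (fun q => mweight q.2 <= tsize t)%N (P t)) ->
  (forall t, (size (P t) <= 2 ^ tsize t)%N) ->
  (forall t, all (fun q => `|q.1| == 1) (P t)) -> tame_by 1 P.
Proof.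
move=> Pw Ps Pn t; split=> //; rewrite mul1n -natrX.
apply: (@le_trans _ _ (size (P t))%:R); last by rewrite ler_nat.
elim: (P t) (Pn t) => [|q l IH] /=; first by rewrite big_nil.
by case/andP=> /eqP q1 /IH lb; rewrite big_cons q1 -natr1 addrC lerD.
Qed.

Lemma mul_fam_tame : tame_by 1 mul_fam.
Proof.
apply: tame_count => t; rewrite /mul_fam.
- rewrite all_map; apply: sub_all (ost_weight t) => -[o l] /= /eqP <-.
  rewrite /mweight map_cat sumn_cat -map_comp /pair_weight /=.
  by case: o => //= r; rewrite addn0.
- by rewrite size_map ost_size.
- by rewrite all_map; elim: (ost t) => //= p l ->; rewrite normr1 eqxx.
Qed.

Lemma inv_fam_tame : tame_by 1 inv_fam.
Proof.
apply: tame_count => t; rewrite /inv_fam.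
- rewrite all_map; apply: sub_all (cuts_weight t) => -[r l] /= /eqP <-.
  by rewrite /mweight /= -map_comp.
- by rewrite size_map; have := cuts_size t; lia.
- rewrite all_map; elim: (cuts t) => //= p l ->.
  by rewrite normrX normrN1 expr1n eqxx.
Qed.

Lemma mul_famE (x y : tfun R) : Mstar x -> Mstar y ->
  mul_chart (x, y) = fval mul_fam ((x, y) : pt (spc (Pair Leaf Leaf))).
Proof.
move=> _ [_ y0]; apply/funext => -[t|]; rewrite /mul_chart /Psi /tadd /tscale /=; last first.
  by rewrite /Psiinv /tadd y0 /= add0r mulr1 subrr.
rewrite mulr0 addr0 /mul_fam big_map; apply: eq_bigr => -[o l] _ /=.
rewrite mul1r /mval big_cat big_map /=; congr (_ * _).
  case: o => [r|]; rewrite /Psiinv /tadd /=.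
    by rewrite big_seq1 addr0.
  by rewrite big_nil y0 add0r.
by apply: eq_bigr => th _; rewrite /Psiinv /tadd /= addr0.
Qed.

Lemma inv_famE (x : tfun R) : inv_chart x = fval inv_fam (x : pt (spc Leaf)).
Proof.
apply/funext => -[t|]; rewrite /inv_chart /Psi /tadd /tscale /=; last first.
  by rewrite mulr1 subrr.
rewrite mulr0 addr0 /inv_fam big_map; apply: eq_bigr => -[r l] _ /=.
rewrite /mval big_cons big_map /=; congr (_ * (_ * _)).
  by rewrite /Psiinv /tadd /= addr0.
by apply: eq_bigr => th _; rewrite /Psiinv /tadd /= addr0.
Qed.

Lemma Mstar_iso (x : tfun R) : Mstar x -> iso_inv x.
Proof. by case=> [[]]. Qed.

Lemma mul_fam_iso : iso_fam mul_fam.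
Proof.
move=> [x y] /= [Mx My]; rewrite -mul_famE // => t u tu.
rewrite /mul_chart /Psi /tadd /tscale /=; congr (_ + _).
have iso (z : tfun R) : Mstar z -> forall o o', otiso o o' -> Psiinv z o = Psiinv z o'.
  move=> Mz [r|] [r'|] //= rr'.
  by rewrite /Psiinv /tadd /= (Mstar_iso Mz rr').
apply: (@ost_sum_invariant R (fun th => Psiinv x (Some th))) tu.
  by move=> r r' rr'; apply: iso.
exact: iso.
Qed.

Lemma inv_fam_iso : iso_fam inv_fam.
Proof.
move=> x Mx; rewrite -inv_famE => t u tu.
rewrite /inv_chart /Psi /tadd /tscale /=; congr (_ + _).
have iso : invariant (fun th => - Psiinv x (Some th)).
  by move=> r r' rr'; rewrite /Psiinv /tadd /= (Mstar_iso Mx rr').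
(* The sign has one factor -1 per component of the forest; distributing it turns the sum into the
   unsigned one for -a. *)
have E r : \sum_(p <- cuts r) (-1) ^+ (size p.2).+1 *
    (Psiinv x (Some p.1) * \prod_(th <- p.2) Psiinv x (Some th)) =
  \sum_(p <- cuts r) (- Psiinv x (Some p.1)) * \prod_(th <- p.2) (- Psiinv x (Some th)).
  apply: eq_bigr => -[r' l] _ /=.
  have -> : \prod_(th <- l) (- Psiinv x (Some th)) =
    (-1) ^+ size l * \prod_(th <- l) Psiinv x (Some th).
    elim: l => [|th l IH]; first by rewrite !big_nil mulr1.
    by rewrite !big_cons IH exprS; ring.
  by rewrite exprS; ring.
rewrite !E; exact: (@cuts_sum_invariant R _ iso _ _ (fun r => - Psiinv x (Some r))).
Qed.

(** * The global chart *)

Lemma BTM_Mstar (a : tfun R) : BTM a -> Mstar (Psi a).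
Proof.
move=> [[ai a0] [c [k [c0 [k0 H]]]]]; split; last first.
  by rewrite /Psi /tadd /tscale a0 mulr1 subrr.
have [N HN] := le_p2 (ltW c0); have [M HM] := le_p2 (ltW k0).
apply/MsetP; split.
  by move=> t u tu; rewrite /Psi /tadd /tscale /= (ai _ _ tu).
exists N, M => -[t|]; rewrite /Psi /tadd /tscale /=; last first.
  by rewrite a0 mulr1 subrr normr0 p2_ge0.
rewrite mulr0 addr0; apply: le_trans (H t) _.
by rewrite exprD exprM ler_pM ?exprn_ge0 ?lerXn2r ?nnegrE ?p2_ge0 // ltW.
Qed.

Lemma Mstar_BTM (x : tfun R) : Mstar x -> BTM (Psiinv x).
Proof.
case/MstarP=> xi x0 [m Hm]; split.
  split; last by rewrite /Psiinv /tadd x0 add0r.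
  by move=> t u tu; rewrite /Psiinv /tadd /= (xi _ _ tu).
exists 1, (p2 m); split=> //; split=> [|t]; first exact: p2_gt0.
by rewrite mul1r -exprM /Psiinv /tadd /= addr0 Hm.
Qed.

Lemma PsiinvK (x : tfun R) : Psi (Psiinv x) = x.
Proof. by apply/funext => t; rewrite /Psi /Psiinv /tadd /tscale; ring. Qed.

Lemma PsiK (a : tfun R) : Psiinv (Psi a) = a.
Proof. by apply/funext => t; rewrite /Psi /Psiinv /tadd /tscale; ring. Qed.

Lemma mul_chart_Mstar (x y : tfun R) : Mstar x -> Mstar y -> Mstar (mul_chart (x, y)).
Proof.
by move=> Mx My; rewrite mul_famE //; apply: (fval_Mstar mul_fam_tame mul_fam_iso).
Qed.

Lemma inv_chart_Mstar (x : tfun R) : Mstar x -> Mstar (inv_chart x).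
Proof.
by move=> Mx; rewrite inv_famE; apply: (fval_Mstar inv_fam_tame inv_fam_iso).
Qed.

End Families.

Theorem theorem2p4 (R : realType) :
  (* B_TM^C is a subgroup of G_TM^C *)
  (forall a b : tfun R, BTM a -> BTM b -> BTM (bprod a b)) /\
  (forall a : tfun R, BTM a -> BTM (binv a)) /\
  (* Psi is a bijection B_TM^C -> M*_C (global chart) *)
  (forall a : tfun R, BTM a -> Mstar (Psi a)) /\
  (forall x : tfun R, Mstar x -> BTM (Psiinv x) /\ Psi (Psiinv x) = x) /\
  (* multiplication and inversion are complex analytic in the chart *)
  @Canalytic R (pspace (MstarSpace R) (MstarSpace R)) (MstarSpace R) (@mul_chart R) /\
  @Canalytic R (MstarSpace R) (MstarSpace R) (@inv_chart R).
Proof.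
split.
  move=> a b /BTM_Mstar Ma /BTM_Mstar Mb.
  (* Closure under products is the stability of M* under the chart expression, transported back by
     [Psiinv]. *)
  rewrite -(PsiK (bprod a b)) -{1}(PsiK a) -{1}(PsiK b); apply: Mstar_BTM.
  exact: (mul_chart_Mstar Ma Mb).
split.
  move=> a /BTM_Mstar Ma; rewrite -(PsiK (binv a)) -{1}(PsiK a); apply: Mstar_BTM.
  exact: inv_chart_Mstar.
split; first exact: BTM_Mstar.
split; first by move=> x Mx; split; [exact: Mstar_BTM|exact: PsiinvK].
split; split.
- by move=> [x y] [Mx My]; apply: mul_chart_Mstar.
- move=> k; apply: (@fam_Ck R k (Pair Leaf Leaf) _ _ _ (@mul_fam_tame R) (@mul_fam_iso R)).
  by move=> [x y] [Mx My]; apply: mul_famE.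
- by move=> x; apply: inv_chart_Mstar.
- move=> k; apply: (@fam_Ck R k Leaf _ _ _ (@inv_fam_tame R) (@inv_fam_iso R)).
  by move=> x _; apply: inv_famE.
Qed.
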